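(* Let $\mathbf{A}\in\{0,1\}^{d\times n}$ and $k\ge 1$. There exist indices $j_1,\dots,j_{2^k-1}\in[n]$ and a bijection $\pi:[2^k-1]\to 2^{[k]}\setminus\{\emptyset\}$ such that the sets $\mathcal{B}_1,\dots,\mathcal{B}_k\subseteq[d]$ produced by the construction below satisfy $\mathrm{Err}(\mathcal{B}_1,\dots,\mathcal{B}_k)\le 2^k\,\mathrm{OPT}_k$. Consequently the Generalized Column Subset Selection procedure, which performs the construction for all such choices and returns the sets of minimum error, outputs $\mathcal{B}_1,\dots,\mathcal{B}_k$ with $\mathrm{Err}(\mathcal{B}_1,\dots,\mathcal{B}_k)\le 2^k\,\mathrm{OPT}_k$.
   Context: Boolean model: the product of binary matrices is over the Boolean semiring, $(\mathbf{U}\mathbf{V})_{ij} = \bigvee_l (u_{il}\wedge v_{lj})$; $\|\mathbf{M}\|_F^2$ is the number of $1$ entries of a binary matrix. $\mathrm{OPT}_k := \min_{\mathbf{U}\in\{0,1\}^{d\times k},\mathbf{V}\in\{0,1\}^{k\times n}}\|\mathbf{A}-\mathbf{U}\mathbf{V}\|_F^2$ (Boolean product). Identify binary vectors in $\{0,1\}^d$ with subsets of $[d]$; let $\mathcal{A}_j\subseteq[d]$ be the $j$th column of $\mathbf{A}$. For sets $\mathcal{B}_1,\dots,\mathcal{B}_k\subseteq[d]$ (the columns of a basis matrix), $\mathrm{Err}(\mathcal{B}_1,\dots,\mathcal{B}_k) := \sum_{j=1}^n \min_{T\subseteq[k]} |\mathcal{A}_j \triangle \bigcup_{i\in T}\mathcal{B}_i|$,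 which equals the minimum over $\mathbf{V}\in\{0,1\}^{k\times n}$ of $\|\mathbf{A}-\mathbf{B}\mathbf{V}\|_F^2$ with $\mathbf{B}$ the matrix of the $\mathcal{B}_i$. Construction: given $j_1,\dots,j_{2^k-1}\in[n]$ (repetitions allowed) and a bijection $\pi$, set $\mathcal{S}_\ell := \pi(\ell)$ and $\mathcal{D}_{\mathcal{S}_\ell} := \mathcal{A}_{j_\ell}$ for $\ell\in[2^k-1]$. For $i\in[k]$, $\ell\in[2^k-1]$ let $\mathcal{E}_i^\ell := \bigcap_{\ell'\ge\ell,\ i\in\mathcal{S}_{\ell'}} \mathcal{D}_{\mathcal{S}_{\ell'}}$ (an empty intersection is $[d]$). For $1\le\ell_1<\ell_2\le 2^k-1$ and $i\in\mathcal{S}_{\ell_1}\cap\mathcal{S}_{\ell_2}$ let $\mathcal{F}_i^{\ell_1,\ell_2} := \mathcal{E}_i^{\ell_1+1}\setminus \bigcup_{i'\in\mathcal{S}_{\ell_2}}\mathcal{E}_{i'}^{\ell_1}$. Finally $\mathcal{B}_i := \mathcal{E}_i^1 \cup \bigcup_{\ell_1<\ell_2:\ i\in\mathcal{S}_{\ell_1}\cap\mathcal{S}_{\ell_2}} \mathcal{F}_i^{\ell_1,\ell_2}$. *)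

(* Defs.v *)
From mathcomp Require Import all_boot all_order all_algebra.

Set Implicit Arguments.
Unset Strict Implicit.
Unset Printing Implicit Defensive.

(* The witness i0 only shows that I is inhabited: see minvalP. *)
Definition minval (I : finType) (i0 : I) (f : I -> nat) : nat :=
  f [arg min_(i < i0) f i].

Lemma minvalP (I : finType) (i0 : I) (f : I -> nat) :
  (exists i, minval i0 f = f i) /\ (forall i, minval i0 f <= f i).
Proof.
rewrite /minval; case: arg_minnP => // i _ le_f.
by split=> [|i']; [exists i | apply: le_f].
Qed.

(* Not *m: mathcomp's ring structure on bool is GF(2), in which sums are
   exclusive ors. *)
Definition bmulmx d k n (U : 'M[bool]_(d, k)) (V : 'M[bool]_(k, n)) :
    'M[bool]_(d, n) :=
  \matrix_(i, j) \big[orb/false]_(l < k) (U i l && V l j).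

(* The integer matrix A - B has entries in {-1, 0, 1}; this is its entrywise
   absolute value, which has the same squared Frobenius norm. *)
Definition bdiffmx d n (A B : 'M[bool]_(d, n)) : 'M[bool]_(d, n) :=
  \matrix_(i, j) (A i j != B i j).

Definition frob2 d n (M : 'M[bool]_(d, n)) : nat :=
  #|[set p : 'I_d * 'I_n | M p.1 p.2]|.

Definition OPT d n (k : nat) (A : 'M[bool]_(d, n)) : nat :=
  minval ((const_mx false, const_mx false) : 'M[bool]_(d, k) * 'M[bool]_(k, n))
    (fun UV => frob2 (bdiffmx A (bmulmx UV.1 UV.2))).

Definition colset d n (A : 'M[bool]_(d, n)) (j : 'I_n) : {set 'I_d} :=
  [set x | A x j].

Definition symdiff (T : finType) (X Y : {set T}) : {set T} :=
  (X :\: Y) :|: (Y :\: X).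

Definition Err d n k (A : 'M[bool]_(d, n)) (B : 'I_k -> {set 'I_d}) : nat :=
  \sum_(j < n) minval (set0 : {set 'I_k})
    (fun T => #|symdiff (colset A j) (\bigcup_(i in T) B i)|).

Definition nonempty_set (k : nat) := {S : {set 'I_k} | S != set0}.

(* Positions l in [2^k - 1] are numbered from 0, as elements of
   'I_(2 ^ k - 1); so setE 0 is the intersection written E_i^1 when counting
   from 1. *)
Section Construction.

Variables (d n k : nat) (A : 'M[bool]_(d, n)).
Variables (j : 'I_(2 ^ k - 1) -> 'I_n) (pi : 'I_(2 ^ k - 1) -> nonempty_set k).

Definition setE (l : nat) (i : 'I_k) : {set 'I_d} :=
  \bigcap_(l' : 'I_(2 ^ k - 1) | (l <= l') && (i \in val (pi l')))
    colset A (j l').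

Definition setF (l1 l2 : 'I_(2 ^ k - 1)) (i : 'I_k) : {set 'I_d} :=
  setE l1.+1 i :\: \bigcup_(i' in val (pi l2)) setE l1 i'.

Definition setB (i : 'I_k) : {set 'I_d} :=
  setE 0 i :|:
  \bigcup_(l1 : 'I_(2 ^ k - 1))
    \bigcup_(l2 : 'I_(2 ^ k - 1) |
        (l1 < l2) && (i \in val (pi l1) :&: val (pi l2)))
      setF l1 l2 i.

End Construction.

(* B may be returned by Generalized Column Subset Selection: it is one of the
   constructed families and has minimum error among all of them. Ties may be
   broken in any way. *)
Definition GCSS_output d n k (A : 'M[bool]_(d, n)) (B : 'I_k -> {set 'I_d}) :
    Prop :=
  (exists (j : 'I_(2 ^ k - 1) -> 'I_n) (pi : 'I_(2 ^ k - 1) -> nonempty_set k),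
     bijective pi /\ B = setB A j pi) /\
  (forall (j : 'I_(2 ^ k - 1) -> 'I_n) (pi : 'I_(2 ^ k - 1) -> nonempty_set k),
     bijective pi -> Err A B <= Err A (setB A j pi)).

(* Main.v *)
Require Import Defs.
From mathcomp Require Import all_boot all_order all_algebra.

Set Implicit Arguments.
Unset Strict Implicit.
Unset Printing Implicit Defensive.

(** Fix an optimal factorization UV and group the columns of A by their pattern
    in V, so that the columns with pattern S approximate the union U_S of the
    columns of U indexed by S.  Let D_S be the column of the group of S closest
    to U_S, and let pi list the patterns by increasing group size.  If a row x
    satisfies D_S(x) = U_S(x) for S and for every S' after S, then the
    construction gives B_S(x) = U_S(x).  Hence replacing U_S by B_S costs at
    most the sum of |D_S' - U_S'| over S' not before S, for each column in the
    group of S; as the group of S' is at least as large and D_S' is closest to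
    U_S', this is at most OPT in total for each of the 2^k - 1 patterns S. *)

Lemma in_symdiff (T : finType) (X Y : {set T}) x :
  (x \in symdiff X Y) = ((x \in X) != (x \in Y)).
Proof. by rewrite !inE; case: (x \in X); case: (x \in Y). Qed.

Lemma card_symdiff_triangle (T : finType) (X Y Z : {set T}) :
  #|symdiff X Z| <= #|symdiff X Y| + #|symdiff Y Z|.
Proof.
rewrite -cardsUI; apply: leq_trans (leq_addr _ _).
apply/subset_leq_card/subsetP=> x; rewrite in_setU !in_symdiff.
by case: (x \in X); case: (x \in Y); case: (x \in Z).
Qed.

Lemma frob2_bdiffmx d n (A B : 'M[bool]_(d, n)) :
  frob2 (bdiffmx A B) = \sum_(j < n) #|symdiff (colset A j) (colset B j)|.
Proof.
rewrite /frob2 -sum1_card big_mkcond /=.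
transitivity (\sum_(p : 'I_d * 'I_n) nat_of_bool (A p.1 p.2 != B p.1 p.2)).
  by apply: eq_bigr => p _; rewrite inE mxE; case: (_ != _).
rewrite -(pair_bigA _ (fun i j => nat_of_bool (A i j != B i j))) /=.
rewrite exchange_big /=.
apply: eq_bigr => j _; rewrite -sum1_card [RHS]big_mkcond /=.
by apply: eq_bigr => i _; rewrite in_symdiff !inE; case: (_ != _).
Qed.

Lemma colset_bmulmx d k n (U : 'M[bool]_(d, k)) (V : 'M[bool]_(k, n)) j :
  colset (bmulmx U V) j = \bigcup_(i in [set i | V i j]) colset U i.
Proof.
apply/setP=> x; rewrite inE mxE big_orE.
apply/existsP/bigcupP => [[i /= /andP[Uxi Vij]]|[i]].
  by exists i; rewrite inE.
by rewrite !inE => Vij Uxi; exists i; rewrite Uxi.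
Qed.

Lemma card_nonempty_set k : #|{: nonempty_set k}| = 2 ^ k - 1.
Proof.
rewrite card_sig (eq_card (B := predC1 set0)) // cardC1.
by rewrite -[#|_|]cardsT -powersetT card_powerset cardsT card_ord subn1.
Qed.

Lemma sorted_enumeration (I : finType) (w : I -> nat) m : #|I| = m ->
  exists2 pi : 'I_m -> I,
    bijective pi & {homo pi : a b / a <= b >-> w a <= w b}.
Proof.
move=> cardI; pose le a b := w a <= w b; pose s := sort le (enum I).
have sz : size s == m by rewrite size_sort -cardE cardI.
have le_tr : transitive le by move=> b a c; apply: leq_trans.
have le_refl : reflexive le by move=> a; rewrite /le.
have srt : sorted le s by apply: sort_sorted => a b; apply: leq_total.
exists (tnth (Tuple sz)) => [|a b le_ab].
  apply: inj_card_bij; last by rewrite card_ord cardI.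
  by apply/tuple_uniqP; rewrite /= sort_uniq enum_uniq.
pose x0 := tnth (Tuple sz) a; rewrite (tnth_nth x0 _ a) (tnth_nth x0 _ b) /=.
by apply: (sorted_leq_nth le_tr le_refl) => //; rewrite inE (eqP sz).
Qed.

Section Rowwise.

Variables (d n k : nat) (A : 'M[bool]_(d, n)).
Variables (j : 'I_(2 ^ k - 1) -> 'I_n) (pi : 'I_(2 ^ k - 1) -> nonempty_set k).
Variable U : 'I_k -> {set 'I_d}.

Lemma in_setE l i x :
  reflect (forall l' : 'I_(2 ^ k - 1), l <= l' -> i \in val (pi l') ->
             x \in colset A (j l'))
          (x \in setE A j pi l i).
Proof.
apply: (iffP bigcapP) => [xE l' le_l Si | xE l' /andP[le_l Si]]; last exact: xE.
by apply: xE; rewrite le_l.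
Qed.

(** If [x] is outside [D_(S_l)], then for [i] in [S_l] every [E_i] of level at most [l] misses [x].
    So only some [F_i^(l1,l2)] with [l1 >= l] could contain [x]; but then [x] lies in [D_(S_l2)],
    hence in [U i'] for some [i'] in [S_l2], hence in the set [E_i'^l1] that [F] removes.
    Conversely, [x] in [U i] puts [x] in [E_i^l], from which [cover] descends to level 0. *)
Lemma setB_cover_correct (l : 'I_(2 ^ k - 1)) x :
  (forall l' : 'I_(2 ^ k - 1), l <= l' ->
     (x \in colset A (j l')) = (x \in \bigcup_(i in val (pi l')) U i)) ->
  (x \in \bigcup_(i in val (pi l)) setB A j pi i) =
  (x \in \bigcup_(i in val (pi l)) U i).
Proof.
move=> DU.
have U_setE (l0 : nat) i : l <= l0 -> x \in U i -> x \in setE A j pi l0 i.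
  move=> le_l xU; apply/in_setE => l' le_l' Si.
  by rewrite DU ?(leq_trans le_l) //; apply/bigcupP; exists i.
apply/idP/idP => [/bigcupP[i Si] | /bigcupP[i Si xU]].
  rewrite -DU //; apply: contraTT => xD.
  have notE (l0 : nat) : l0 <= l -> x \notin setE A j pi l0 i.
    by move=> le_l0; apply: contraNN xD => /in_setE; apply.
  rewrite in_setU negb_or notE //=; apply/bigcupP => -[l1 _ /bigcupP[l2]].
  case/andP=> lt12 /setIP[_ Si2] /setDP[xE1 /bigcupP].
  have lt_l : l <= l1 by rewrite leqNgt; apply: contraTN xE1 => /notE.
  have /in_setE/(_ l2 lt12 Si2) := xE1.
  rewrite DU ?(leq_trans lt_l (ltnW lt12)) // => /bigcupP[i' Si' xU'].
  by case; exists i' => //; apply: U_setE.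
(* Lowering the level shrinks each [setE]. If [x] survives down to level 0, it is in some [E_i^1]
   (counting from 1); if no [E_i] with [i] in [S_l] keeps it on passing from [l0.+1] to [l0], then
   [F_i0^(l0,l)] recovers it. *)
have cover (l0 : nat) : l0 <= l ->
    x \in \bigcup_(i in val (pi l)) setE A j pi l0 i ->
    x \in \bigcup_(i in val (pi l)) setB A j pi i.
  elim: l0 => [|l0 IH] le_l0.
    case/bigcupP=> i0 Si0 xE; apply/bigcupP; exists i0 => //.
    by rewrite in_setU xE.
  have [/(IH (ltnW le_l0)) // | xE'] :=
    boolP (x \in \bigcup_(i in val (pi l)) setE A j pi l0 i).
  case/bigcupP=> i0 Si0 xE; apply/bigcupP; exists i0 => //.
  pose l1 := Ordinal (ltn_trans le_l0 (ltn_ord l)).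
  (* Of the sets defining E_i0^l0 only D_l1 is missing from E_i0^(l0+1), so
     S_l1 contains i0. *)
  have Si1 : i0 \in val (pi l1).
    apply: contraNT xE' => Si1; apply/bigcupP; exists i0 => //.
    apply/in_setE => l'; rewrite leq_eqVlt => /orP[/eqP eq_l | lt_l] Si'.
      by rewrite (_ : l1 = l') ?Si' // in Si1; apply: val_inj.
    by move/in_setE: xE; apply.
  rewrite in_setU; apply/orP; right; apply/bigcupP; exists l1 => //.
  apply/bigcupP; exists l; first by rewrite le_l0 in_setI Si1.
  by apply/setDP.
by apply: (cover l) => //; apply/bigcupP; exists i => //; apply: U_setE.
Qed.

(** By [setB_cover_correct], a row where the two unions differ is an error row of some position from
    [l] on; the union bound concludes. *)
Lemma card_symdiff_setB (l : 'I_(2 ^ k - 1)) :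
  #|symdiff (\bigcup_(i in val (pi l)) U i)
            (\bigcup_(i in val (pi l)) setB A j pi i)| <=
  \sum_(l' : 'I_(2 ^ k - 1) | l <= l')
    #|symdiff (colset A (j l')) (\bigcup_(i in val (pi l')) U i)|.
Proof.
set X := symdiff _ _; pose Y (l' : 'I_(2 ^ k - 1)) :=
  symdiff (colset A (j l')) (\bigcup_(i in val (pi l')) U i).
have XY : X \subset \bigcup_(l' : 'I_(2 ^ k - 1) | l <= l') Y l'.
  apply/subsetP=> x; apply: contraTT => /bigcupP xY.
  rewrite in_symdiff negbK eq_sym setB_cover_correct // => l' le_l.
  apply/eqP; apply/negPn/negP; rewrite -in_symdiff => xYl.
  by apply: xY; exists l'.
apply: leq_trans (subset_leq_card XY) _.
elim/big_rec2: _ => [|l' m Z _ le_Zm]; first by rewrite cards0.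
by apply: leq_trans (leq_card_setU _ _) _; rewrite leq_add2l.
Qed.

End Rowwise.

Lemma Err_le d n k (A : 'M[bool]_(d, n)) (B : 'I_k -> {set 'I_d})
    (T : 'I_n -> {set 'I_k}) :
  Err A B <= \sum_(j < n) #|symdiff (colset A j) (\bigcup_(i in T j) B i)|.
Proof.
pose f j (S : {set 'I_k}) := #|symdiff (colset A j) (\bigcup_(i in S) B i)|.
by apply: leq_sum => j _; case: (minvalP set0 (f j)) => _ /(_ (T j)).
Qed.

Lemma exists_setB_Err_le d n k (A : 'M[bool]_(d, n)) (U : 'I_k -> {set 'I_d})
    (T : 'I_n -> {set 'I_k}) : 0 < n ->
  exists (j : 'I_(2 ^ k - 1) -> 'I_n) (pi : 'I_(2 ^ k - 1) -> nonempty_set k),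
    bijective pi /\
    Err A (setB A j pi) <=
      2 ^ k * \sum_(c < n) #|symdiff (colset A c) (\bigcup_(i in T c) U i)|.
Proof.
move=> n_gt0.
pose US (S : {set 'I_k}) := \bigcup_(i in S) U i.
pose err (S : {set 'I_k}) (c : 'I_n) := #|symdiff (colset A c) (US S)|.
pose w (S : nonempty_set k) := #|[set c | T c == val S]|.
(* The least error in a group is at most the average. An empty group has weight 0, so any column
   represents it, and [0 < n] supplies one. *)
have best (S : nonempty_set k) :
    exists c0, w S * err (val S) c0 <= \sum_(c | T c == val S) err (val S) c.
  have [c1 Tc1 | T0] := pickP (fun c => T c == val S); last first.
    exists (Ordinal n_gt0); rewrite /w (eq_card0 (A := [set c | _])) // => c.
    by rewrite inE T0.
  case: (@arg_minnP _ c1 (fun c => T c == val S) (err (val S)) Tc1).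
  move=> c0 _ min_c0; exists c0.
  rewrite /w -sum_nat_const; under eq_bigl => c do rewrite inE.
  exact: leq_sum.
have [rep repP] := fin_all_exists best.
have [pi bij_pi mono] := sorted_enumeration w (card_nonempty_set k).
exists (rep \o pi), pi; split=> //.
set B := setB _ _ _; set opt := \sum_(c < n) _.
pose BS (S : {set 'I_k}) := \bigcup_(i in S) B i.
(* Since [pi] is a bijection, each column with a nonempty pattern is counted at exactly one
   position. *)
have by_pattern (f : {set 'I_k} -> 'I_n -> nat) :
    \sum_(l < 2 ^ k - 1) \sum_(c | T c == val (pi l)) f (T c) c =
    \sum_(c | T c != set0) f (T c) c.
  transitivity (\sum_(S : nonempty_set k) \sum_(c | T c == val S) f (T c) c).
    by rewrite [RHS](reindex pi) //; apply: onW_bij.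
  rewrite (exchange_big_dep (fun c => T c != set0)) /=; last first.
    by move=> S c _ /eqP ->; apply: (valP S).
  apply: eq_bigr => c Tc; rewrite (big_pred1 (Sub (T c) Tc)) // => S.
  by rewrite /= -val_eqE /= eq_sym.
have rep_total :
    \sum_(l < 2 ^ k - 1) w (pi l) * err (val (pi l)) (rep (pi l)) <= opt.
  apply: (@leq_trans (\sum_(c | T c != set0) err (T c) c)).
    rewrite -by_pattern; apply: leq_sum => l _; apply: leq_trans (repP _) _.
    by apply: leq_sum => c /eqP ->.
  by rewrite [opt](bigID (fun c => T c != set0)) leq_addr.
(* Columns with empty pattern cost nothing, both unions being empty; each of the [2 ^ k - 1]
   positions costs at most [opt]. *)
have perturb :
    \sum_(c < n) #|symdiff (US (T c)) (BS (T c))| <= (2 ^ k - 1) * opt.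
  rewrite (bigID (fun c => T c != set0)) /= addnC.
  rewrite big1 ?add0n => [|c]; last first.
    rewrite negbK => /eqP ->; rewrite /US /BS !big_set0.
    by apply/eqP; rewrite cards_eq0 /symdiff setDv setU0.
  rewrite -(by_pattern (fun S _ => #|symdiff (US S) (BS S)|)).
  rewrite -[X in _ <= X * _]card_ord -sum_nat_const; apply: leq_sum => l _.
  apply: leq_trans rep_total.
  apply: (@leq_trans (w (pi l) * #|symdiff (US (val (pi l))) (BS (val (pi l)))|)).
    rewrite /w -sum_nat_const; under [leqRHS]eq_bigl => c do rewrite inE.
    by apply: leq_sum => c /eqP ->.
  (* Only positions [l' >= l] contribute, and there [mono] lets [w (pi l')] replace [w (pi l)],
     which gives the terms of [rep_total]. *)
  apply: leq_trans (leq_mul (leqnn _) (card_symdiff_setB A _ pi U l)) _.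
  rewrite big_distrr big_mkcond /=; apply: leq_sum => l' _.
  by case: ifP => // le_l; rewrite leq_mul2r mono ?orbT.
apply: leq_trans (Err_le A B T) _.
apply: (@leq_trans (opt + (2 ^ k - 1) * opt)).
  apply: leq_trans (leq_add (leqnn opt) perturb).
  rewrite -big_split; apply: leq_sum => c _; exact: card_symdiff_triangle.
by rewrite -mulSn subn1 prednK ?expn_gt0.
Qed.

(** Pointwise equal families may have different minimizers in [minval], so the two minima are
    compared by inequalities both ways. *)
Lemma eq_Err d n k (A : 'M[bool]_(d, n)) (B B' : 'I_k -> {set 'I_d}) :
  B =1 B' -> Err A B = Err A B'.
Proof.
move=> eqB; apply: eq_bigr => c _.
pose f (C : 'I_k -> {set 'I_d}) (S : {set 'I_k}) :=
  #|symdiff (colset A c) (\bigcup_(i in S) C i)|.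
have eqf : f B =1 f B' by move=> S; rewrite /f; under eq_bigr do rewrite eqB.
have [[S fS] leS] := minvalP (set0 : {set 'I_k}) (f B).
have [[S' fS'] leS'] := minvalP (set0 : {set 'I_k}) (f B').
apply/eqP; rewrite eqn_leq -/(f B) -/(f B').
by rewrite {1}fS' -eqf leS fS eqf leS'.
Qed.

Lemma eq_setB d n k (A : 'M[bool]_(d, n)) (j j' : 'I_(2 ^ k - 1) -> 'I_n)
    (pi pi' : 'I_(2 ^ k - 1) -> nonempty_set k) :
  j =1 j' -> pi =1 pi' -> setB A j pi =1 setB A j' pi'.
Proof.
move=> eqj eqpi i; have eqE l : setE A j pi l =1 setE A j' pi' l.
  by move=> i'; apply: eq_big => [l'|l' _]; rewrite ?eqpi ?eqj.
rewrite /setB eqE; congr (_ :|: _); apply: eq_bigr => l1 _.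
apply: eq_big => [l2|l2 _]; first by rewrite !eqpi.
by rewrite /setF eqE eqpi; under eq_bigr do rewrite eqE.
Qed.

(** Choices are encoded as finite functions, so that a minimum exists over a finite type.
    Injectivity is a decidable form of bijectivity here, as both sides have [2 ^ k - 1] elements. *)
Lemma GCSS_output_exists d n k (A : 'M[bool]_(d, n))
    (j : 'I_(2 ^ k - 1) -> 'I_n) (pi : 'I_(2 ^ k - 1) -> nonempty_set k) :
  bijective pi -> exists B, @GCSS_output d n k A B.
Proof.
move=> bij_pi.
pose choice : finType :=
  ({ffun 'I_(2 ^ k - 1) -> 'I_n} * {ffun 'I_(2 ^ k - 1) -> nonempty_set k})%type.
pose ok (p : choice) := injectiveb p.2.
have okP (j' : 'I_(2 ^ k - 1) -> 'I_n) (pi' : 'I_(2 ^ k - 1) -> nonempty_set k) :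
    bijective pi' -> ok (finfun j', finfun pi').
  by move=> /bij_inj inj; apply/injectiveP=> a b; rewrite !ffunE => /inj.
case: (@arg_minnP _ _ ok (fun p => Err A (setB A p.1 p.2)) (okP j pi bij_pi)).
move=> p /injectiveP inj_p min_p; exists (setB A p.1 p.2); split.
  exists p.1, p.2; split=> //; apply: inj_card_bij inj_p _.
  by rewrite card_ord card_nonempty_set.
move=> j' pi' /(okP j') /min_p le_p; apply: leq_trans le_p _.
by rewrite (eq_Err A (eq_setB A (ffunE j') (ffunE pi'))).
Qed.

Theorem theorem4 (d n k : nat) (A : 'M[bool]_(d, n)) (hn : 0 < n)
    (hk : 1 <= k) :
  (exists (j : 'I_(2 ^ k - 1) -> 'I_n)
          (pi : 'I_(2 ^ k - 1) -> nonempty_set k),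
      bijective pi /\ Err A (setB A j pi) <= 2 ^ k * OPT k A) /\
  (exists B : 'I_k -> {set 'I_d}, GCSS_output A B) /\
  (forall B : 'I_k -> {set 'I_d},
      GCSS_output A B -> Err A B <= 2 ^ k * OPT k A).
Proof.
have [j [pi [bij_pi leErr]]] : exists (j : 'I_(2 ^ k - 1) -> 'I_n)
    (pi : 'I_(2 ^ k - 1) -> nonempty_set k),
    bijective pi /\ Err A (setB A j pi) <= 2 ^ k * OPT k A.
  pose f (UV : 'M[bool]_(d, k) * 'M[bool]_(k, n)) :=
    frob2 (bdiffmx A (bmulmx UV.1 UV.2)).
  (* For an optimal pair, the pattern of column [c] is the support of column [c] of [V]. *)
  have [[[U V] minUV] _] := minvalP (const_mx false, const_mx false) f.
  rewrite /OPT minUV /f frob2_bdiffmx; under eq_bigr do rewrite colset_bmulmx.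
  exact: exists_setB_Err_le.
split; first by exists j, pi.
split=> [|B [_ minB]]; first exact: GCSS_output_exists bij_pi.
exact: leq_trans (minB j pi bij_pi) leErr.
Qed.
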